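(* Let $X_1,\dots,X_n$ be independent random vectors, $G=(V,E)$ a graph on $V=\{1,\dots,n\}$, $\{h_e\}_{e\in E}$ a collection of bivariate kernels, and $U=\sum_{e=(i,j)\in E}h_e(X_i,X_j)$. Suppose that for every $e=(i,j)\in E$ there exists $\sigma_e>0$ such that $$\mathbb{E}\Bigl[e^{\lambda\{h_e(X_i,X_j)-\mathbb{E}h_e(X_i,X_j)\}}\Bigr]\le e^{\lambda^2\sigma_e^2/2}\qquad\text{for all }\lambda>0.$$ If there exists a proper $K$-edge-coloring of $G$, then for all $t>0$, $$\mathbb{P}(U-\mathbb{E}U>t)\le \exp\left\{-\frac{t^2}{2K\sum_{e\in E}\sigma_e^2}\right\}.$$
   Context: The random vectors $X_1,\dots,X_n\in\mathbb{R}^p$ are independent but not necessarily identically distributed. $G=(V,E)$ is an arbitrary deterministic simple undirected graph with at least one edge; each edge $e\in E$ is written as a pair $e=(i,j)$ in one fixed order of its endpoints. For each $e\in E$, $h_e:\mathbb{R}^p\times\mathbb{R}^p\to\mathbb{R}$ is a measurable function (kernel), which may depend on $e$ and need not be symmetric; the expectations $\mathbb{E}h_e(X_i,X_j)$ are finite. A proper $K$-edge-coloring of $G$ is an assignment of one of $K$ colors to each edge such that no two distinct edges sharing a common node have the same color. *)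

(* Defs.v *)
From HB Require Import structures.
From mathcomp Require Import all_boot all_order all_algebra.
From mathcomp Require Import all_classical all_reals all_analysis.
Import Order.TTheory GRing.Theory Num.Theory.
Import numFieldNormedType.Exports.

Set Implicit Arguments.
Unset Strict Implicit.
Unset Printing Implicit Defensive.

Local Open Scope classical_set_scope.
Local Open Scope ring_scope.

Definition mutually_independent (d d' : measure_display) (T : measurableType d)
    (T' : measurableType d') (R : realType) (P : probability T R)
    (I : finType) (X : I -> {RV P >-> T'}) : Prop :=
  forall (J : {set I}) (B : I -> set T'),
    (forall i, i \in J -> measurable (B i)) ->
    P (\bigcap_(i in [set` J]) (X i @^-1` B i)) =
    (\prod_(i in J) P (X i @^-1` B i))%E.

(* A simple undirected graph on V is given by its edge set, each edge being the
   unordered pair of its two distinct endpoints. *)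
Definition simple_graph (V : finType) (E : {set {set V}}) : Prop :=
  forall e, e \in E -> #|e| = 2%N.

(* ends e = (i, j) fixes the order in which the endpoints of the edge e are
   written; its values outside E are irrelevant. *)
Definition edge_ordering (V : finType) (E : {set {set V}})
    (ends : {set V} -> V * V) : Prop :=
  forall e, e \in E -> e = [set (ends e).1; (ends e).2]%SET.

Definition proper_edge_coloring (V : finType) (E : {set {set V}}) (K : nat)
    (c : {set V} -> 'I_K) : Prop :=
  forall e f, e \in E -> f \in E -> e != f -> e :&: f != finset.set0 ->
    c e != c f.

(* p.-tuple R carries the product sigma-algebra, which is the Borel
   sigma-algebra of R^p. *)
Definition edge_kernel (d : measure_display) (T : measurableType d)
    (R : realType) (P : probability T R) (p n : nat)
    (X : 'I_n -> {RV P >-> p.-tuple R})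
    (ends : {set 'I_n} -> 'I_n * 'I_n)
    (h : {set 'I_n} -> p.-tuple R -> p.-tuple R -> R)
    (e : {set 'I_n}) : T -> R :=
  fun w => h e (X (ends e).1 w) (X (ends e).2 w).

Definition graph_Ustat (d : measure_display) (T : measurableType d)
    (R : realType) (P : probability T R) (p n : nat)
    (X : 'I_n -> {RV P >-> p.-tuple R})
    (E : {set {set 'I_n}}) (ends : {set 'I_n} -> 'I_n * 'I_n)
    (h : {set 'I_n} -> p.-tuple R -> p.-tuple R -> R) : T -> R :=
  fun w => \sum_(e in E) edge_kernel X ends h e w.

(* Main.v *)
Require Import Defs.
From HB Require Import structures.
From mathcomp Require Import all_boot all_order all_algebra.
From mathcomp Require Import all_classical all_reals all_analysis.
From mathcomp Require Import measurable_realfun.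
From mathcomp Require Import ring.
Import Order.TTheory GRing.Theory Num.Theory.
Import numFieldNormedType.Exports.

(** The edges of one color form a matching, so within a color class the centred
    kernels depend on disjoint blocks of the independent vectors: they are
    independent, and the sum Y_k over color k is sub-Gaussian with variance
    proxy v_k, the sum of sigma_e^2 over that color
    ([upper_subgaussian_matching]).  The sums Y_k of different colors depend on
    each other in an uncontrolled way; they are combined by convexity of the
    exponential alone.  For weights p_k > 0 of sum 1,

      exp (lambda * sum_k Y_k) <= sum_k p_k * exp ((lambda / p_k) * Y_k),

    and the choice of p_k proportional to sqrt v_k makes all the bounds on the
    right equal: sum_k Y_k is sub-Gaussian with proxy (sum_k sqrt v_k)^2
    ([upper_subgaussian_sum]), which Cauchy-Schwarz bounds by K * sum_k v_k
    ([sqr_sum_le_card]).  The Chernoff bound at lambda = t / proxy concludes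
    ([upper_subgaussian_tail]).

    Independence of the kernels over a matching is derived from independence of
    the coordinates by consuming two coordinates per edge.  The invariant
    [indep_coords X J Y] says that Y is independent of the coordinates in J;
    pairing Y with one of these coordinates keeps the invariant for the others
    ([indep_coords_absorb]), because measures on a product are determined by
    rectangles ([event_indep_pair]). *)

Set Implicit Arguments.
Unset Strict Implicit.
Unset Printing Implicit Defensive.

Local Open Scope classical_set_scope.
Local Open Scope ring_scope.

(** * Independence from a block of coordinates *)

Lemma measurable_preimage d (T : measurableType d) d1 (S : measurableType d1)
    (Y : T -> S) (A : set S) :
  measurable_fun setT Y -> measurable A -> measurable (Y @^-1` A).
Proof. by move=> mY mA; rewrite -[X in measurable X]setTI; exact: mY. Qed.

Section independence.
Context d (T : measurableType d) (R : realType) (P : probability T R).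
Local Open Scope ereal_scope.

(** Both sides are finite measures in D, and the rectangles are stable under
    intersection and generate the product sigma-algebra. *)
Lemma event_indep_pair d1 d2 (S1 : measurableType d1) (S2 : measurableType d2)
    (Y : T -> S1) (Z : T -> S2) (C : set T) :
  measurable_fun setT Y -> measurable_fun setT Z -> measurable C ->
  (forall A B, measurable A -> measurable B ->
     P (C `&` (Y @^-1` A `&` Z @^-1` B)) = P C * P (Y @^-1` A `&` Z @^-1` B)) ->
  forall D : set (S1 * S2), measurable D ->
    P (C `&` (fun w => (Y w, Z w)) @^-1` D) =
    P C * P ((fun w => (Y w, Z w)) @^-1` D).
Proof.
move=> mY mZ mC CYZ D mD.
have mW := measurable_fun_pair mY mZ.
set W := fun w => (Y w, Z w) in mW *.
have PC0 : (0 <= fine (P C))%R by rewrite fine_ge0.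
(* The measure structure of a pushforward takes the measurability of the map
   as an argument, whence the applications to mW. *)
pose m1 : {measure set (S1 * S2) -> \bar R} := pushforward (mrestr P mC) W.
pose m2 : {measure set (S1 * S2) -> \bar R} :=
  mscale (NngNum PC0) (pushforward P W).
have PCE : (fine (P C))%:E = P C by rewrite fineK// fin_num_measure.
have m1E A : m1 mW A = P (C `&` W @^-1` A) by rewrite setIC.
have m2E A : m2 mW A = P C * P (W @^-1` A) by rewrite -PCE.
rewrite -m1E -m2E.
pose G : set (set (S1 * S2)) :=
  [set A `*` B | A in measurable & B in measurable].
apply: (measure_unique G (fun=> setT) ) => //.
- by rewrite measurable_prod_measurableType.
- move=> _ _ [A1 mA1 [B1 mB1 <-]] [A2 mA2 [B2 mB2 <-]].
  exists (A1 `&` A2); first exact: measurableI.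
  exists (B1 `&` B2); first exact: measurableI.
  by rewrite setXI.
- by move=> _; exists setT => //; exists setT => //; rewrite setXTT.
- by rewrite bigcup_const.
- move=> _ [A mA [B mB <-]].
  by rewrite m1E m2E; exact: CYZ.
- by move=> _; rewrite m1E preimage_setT setIT -ge0_fin_numE// fin_num_measure.
Qed.

(** Independence identifies the law of (Y, Z) with the product of the laws, and
    Tonelli splits the double integral. *)
Lemma expectation_prod_indep (Y Z : T -> R) :
  measurable_fun setT Y -> measurable_fun setT Z ->
  (forall w, 0 <= Y w)%R -> (forall w, 0 <= Z w)%R ->
  (forall A B, measurable A -> measurable B ->
     P (Y @^-1` A `&` Z @^-1` B) = P (Y @^-1` A) * P (Z @^-1` B)) ->
  'E_P[fun w => (Y w * Z w)%R] = 'E_P[Y] * 'E_P[Z].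
Proof.
move=> mY mZ Y0 Z0 indep.
pose Y_mixin := isMeasurableFun.Build _ _ _ _ _ mY.
pose Yr : {mfun T >-> R} := HB.pack Y Y_mixin.
pose Z_mixin := isMeasurableFun.Build _ _ _ _ _ mZ.
pose Zr : {mfun T >-> R} := HB.pack Z Z_mixin.
have mW := measurable_fun_pair mY mZ.
pose W_mixin := isMeasurableFun.Build _ _ _ _ _ mW.
pose W : {mfun T >-> (R * R)%type} := HB.pack (fun w => (Y w, Z w)) W_mixin.
have lawW A : measurable A ->
    (distribution P Yr \x distribution P Zr) A = distribution P W A.
  by apply: product_measure_unique => B C mB mC; exact: indep.
(* The integrand on R is the absolute value, so as to be nonnegative also off
   the ranges of Y and Z. *)
have normE (V : {mfun T >-> R}) : (forall w, 0 <= V w)%R ->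
    'E_P[V] = \int[distribution P V]_y `|y|%:E.
  move=> V0; rewrite unlock ge0_integral_distribution//=.
    by apply: eq_integral => w _ /=; rewrite ger0_norm.
  by apply/measurable_EFinP; exact: normr_measurable.
have mf : measurable_fun [set: R * R] (fun z : R * R => (`|z.1| * `|z.2|)%:E).
  apply/measurable_EFinP; apply: measurable_funM.
    by apply: measurableT_comp => //; exact: measurable_fst.
  by apply: measurableT_comp => //; exact: measurable_snd.
transitivity (\int[distribution P W]_z (`|z.1| * `|z.2|)%:E).
  rewrite unlock ge0_integral_distribution//=.
    by apply: eq_integral => w _ /=; rewrite !ger0_norm.
transitivity (\int[distribution P Yr \x distribution P Zr]_z
    (`|z.1| * `|z.2|)%:E).
  by apply: eq_measure_integral => A mA _; exact/esym/lawW.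
rewrite fubini_tonelli1//= (normE Yr)// (normE Zr)//.
have mn : measurable_fun [set: R] (fun x : R => `|x|%:E).
  by apply/measurable_EFinP; exact: normr_measurable.
rewrite /fubini_F/=.
under eq_integral => y _ do under eq_integral => z _ do rewrite EFinM.
under eq_integral => y _ do rewrite ge0_integralZl_EFin//.
by rewrite ge0_integralZr// integral_ge0.
Qed.

(** The right-hand side is a product over L, rather than the probability of the
    intersection over L, so that the definition also carries the mutual
    independence of the coordinates in J (take A to be the whole space). *)
Definition indep_coords dS (S : measurableType dS) (I : finType)
    dX (T' : measurableType dX) (X : I -> {RV P >-> T'})
    (J : {set I}) (Y : T -> S) : Prop :=
  forall (L : {set I}) (B : I -> set T') (A : set S), L \subset J ->
    (forall i, i \in L -> measurable (B i)) -> measurable A ->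
    P (Y @^-1` A `&` \bigcap_(i in [set` L]) (X i @^-1` B i)) =
    P (Y @^-1` A) * \prod_(i in L) P (X i @^-1` B i).

Section indep_coords.
Context dS (S : measurableType dS) (I : finType) dX (T' : measurableType dX).
Variable X : I -> {RV P >-> T'}.

Lemma indep_coords_cst (c : S) (J : {set I}) :
  mutually_independent X -> indep_coords X J (cst c).
Proof.
move=> indX L B A _ mB mA; rewrite preimage_cst; case: ifPn => _.
  by rewrite setTI probability_setT mul1e; exact: indX.
by rewrite set0I measure0 mul0e.
Qed.

Lemma indep_coords_comp dU (U : measurableType dU) (J : {set I})
    (Y : T -> S) (g : S -> U) :
  measurable_fun setT g -> indep_coords X J Y -> indep_coords X J (g \o Y).
Proof.
move=> mg indY L B A LJ mB mA; rewrite comp_preimage.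
by apply: indY => //; exact: measurable_preimage.
Qed.

Lemma pset_set1 (i : I) : [set` [set i]%SET] = [set i].
Proof. by apply/seteqP; split=> j /=; rewrite inE => /eqP. Qed.

Lemma pset_setU1 (i : I) (L : {set I}) : [set` (i |: L)%SET] = i |` [set` L].
Proof.
apply/seteqP; split=> j /=.
  by rewrite !inE => /orP[/eqP|]; [left|right].
by case=> [->|jL]; rewrite !inE ?eqxx// (jL : j \in L) orbT.
Qed.

(** Apply [event_indep_pair] to the pair (Y, X i) and the event C constraining
    the other coordinates: on a rectangle, the event on X i is one more factor
    of the product in [indep_coords]. *)
Lemma indep_coords_absorb (J : {set I}) (Y : T -> S) (i : I) :
  measurable_fun setT Y -> mutually_independent X ->
  i \in J -> indep_coords X J Y ->
  indep_coords X (J :\ i)%SET (fun w => (Y w, X i w)).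
Proof.
move=> mY indX iJ indY L B D LJ mB mD.
have iL : i \notin L by apply/negP => /(fintype.subsetP LJ); rewrite !inE eqxx.
have LJ' : L \subset J by rewrite (fintype.subset_trans LJ)// subsetDl.
have mC : measurable (\bigcap_(k in [set` L]) (X k @^-1` B k)).
  apply: fin_bigcap_measurable => // k kL.
  by apply: measurable_preimage => //; exact: mB.
rewrite setIC -indX// [RHS]muleC; apply: event_indep_pair => // A1 A2 mA1 mA2.
pose B' k := if k == i then A2 else B k.
have B'L k : k \in L -> B' k = B k.
  by rewrite /B'; case: eqP => // -> ; rewrite (negbTE iL).
have mB' k : k \in (i |: L)%SET -> measurable (B' k).
  by rewrite /B' !inE; case: eqP => //= _; exact: mB.
have B'i : B' i = A2 by rewrite /B' eqxx.
have := indY [set i]%SET B' A1.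
rewrite finset.sub1set pset_set1 bigcap_set1 big_set1 B'i => ->//; last first.
  by move=> k; rewrite inE => /eqP->; rewrite B'i.
have := indY (i |: L)%SET B' A1.
rewrite finset.subUset finset.sub1set iJ LJ' pset_setU1 bigcap_setU1.
rewrite big_setU1//= B'i.
under eq_bigcapr => k kL do rewrite B'L//.
under eq_bigr => k kL do rewrite B'L//.
rewrite indX// => /(_ isT mB' mA1) E.
by rewrite setIC -setIA E muleA muleC.
Qed.

(** The expectation of a product over a matching splits off one edge at a time;
    this is the independence it needs, of an edge (X i, X j) from the product Y
    over the other edges. *)
Lemma indep_coords_pair (J : {set I}) (Y : T -> S) (i j : I)
    (A : set S) (D : set (T' * T')) :
  measurable_fun setT Y -> i \in J -> j \in J -> i != j ->
  indep_coords X J Y -> measurable A -> measurable D ->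
  P (Y @^-1` A `&` (fun w => (X i w, X j w)) @^-1` D) =
  P (Y @^-1` A) * P ((fun w => (X i w, X j w)) @^-1` D).
Proof.
move=> mY iJ jJ ij indY mA mD; apply: event_indep_pair => //.
  exact: measurable_preimage.
move=> B1 B2 mB1 mB2.
pose B k := if k == i then B1 else B2.
have mB k : measurable (B k) by rewrite /B; case: ifP.
have Bi : B i = B1 by rewrite /B eqxx.
have Bj : B j = B2 by rewrite /B eq_sym (negbTE ij).
have LJ : (i |: [set j])%SET \subset J.
  by rewrite finset.subUset !finset.sub1set iJ.
have := indY (i |: [set j])%SET B setT LJ (fun k _ => mB k) measurableT.
have := indY (i |: [set j])%SET B A LJ (fun k _ => mB k) mA.
rewrite pset_setU1 bigcap_setU1 pset_set1 bigcap_set1 Bi Bj preimage_setT setTI.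
by rewrite probability_setT mul1e => -> ->.
Qed.

End indep_coords.
End independence.

(** * Products over a matching *)

Section matching.
Context d (T : measurableType d) (R : realType) (P : probability T R).
Context (I : finType) dX (T' : measurableType dX) (X : I -> {RV P >-> T'}).
Context (A : Type) (ends : A -> I * I) (f : A -> T' -> T' -> R).
Hypothesis indX : mutually_independent X.
Hypothesis mf : forall e, measurable_fun setT (fun z : T' * T' => f e z.1 z.2).
Hypothesis f0 : forall e x y, 0 <= f e x y.

Let W e w := f e (X (ends e).1 w) (X (ends e).2 w).
Let span e := [set (ends e).1; (ends e).2]%SET.

Let mX2 i j : measurable_fun setT (fun w => (X i w, X j w)).
Proof. exact: measurable_fun_pair. Qed.

Let mW e : measurable_fun setT (W e).
Proof. exact: (measurableT_comp (mf e) (mX2 _ _)). Qed.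

(** The independence of the product from the untouched vertices is the
    induction invariant; the factorisation of the expectation is the conclusion
    of interest. *)
Lemma matching_indep (s : seq A) :
  all (fun e => (ends e).1 != (ends e).2) s ->
  pairwise (fun e e' => span e :&: span e' == finset.set0) s ->
  indep_coords X (~: \bigcup_(e <- s) span e)%SET
    (fun w => \prod_(e <- s) W e w) /\
  ('E_P[fun w => (\prod_(e <- s) W e w)%R] = \prod_(e <- s) 'E_P[W e])%E.
Proof.
elim: s => [_ _|e s IHs /= /andP[e12 s12] /andP[es disj_s]].
  have -> : (fun w => \prod_(e <- [::]) W e w) = cst 1.
    by apply/funext => w; rewrite big_nil.
  rewrite [RHS in _ /\ _ = RHS]big_nil; split; last exact: expectation_cst.
  exact: (@indep_coords_cst _ _ _ _ _ _ _ _ _ X (1 : R)).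
have [indG EG] := IHs s12 disj_s.
set G := fun w => \prod_(e <- s) W e w in indG EG.
set J := (~: _)%SET in indG.
have mG : measurable_fun setT G.
  rewrite /G => {IHs s12 disj_s es indG EG G J}.
  elim: s => [|a s IHs].
    by under eq_fun do rewrite big_nil; exact: measurable_cst.
  by under eq_fun do rewrite big_cons; exact: measurable_funM.
have JE : (~: \bigcup_(a <- e :: s) span a)%SET =
          (J :\ (ends e).1 :\ (ends e).2)%SET.
  apply/setP => i; rewrite big_cons /J !inE negb_or andbA andbC.
  by do 3 case: (_ \in _) || case: (_ == _).
have eJ i : i \in span e -> i \in J.
  move=> ie; rewrite inE.
  elim: (s) es => [|a s' IH] /=; first by rewrite big_nil inE.
  move=> /andP[ea /IH is']; rewrite big_cons inE negb_or is' andbT.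
  by apply: contraTN ea => ia; apply/set0Pn; exists i; rewrite inE ie.
have e1J : (ends e).1 \in J by apply: eJ; rewrite !inE eqxx.
have e2J : (ends e).2 \in J by apply: eJ; rewrite !inE eqxx orbT.
have -> : (fun w => \prod_(a <- e :: s) W a w) = (fun w => W e w * G w).
  by apply/funext => w; rewrite big_cons.
split.
- rewrite JE.
  pose g (z : R * T' * T') := f e z.1.2 z.2 * z.1.1.
  have mg : measurable_fun setT g.
    apply: measurable_funM.
      apply: (measurableT_comp (mf e) (_ : measurable_fun setT
        (fun z : R * T' * T' => (z.1.2, z.2)))).
      apply: measurable_fun_pair => //.
      by apply: measurableT_comp => //; exact: measurable_fst.
    by apply: measurableT_comp => //; exact: measurable_fst.
  apply: (indep_coords_comp
    (Y := fun w => (G w, X (ends e).1 w, X (ends e).2 w)) mg).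
  apply: indep_coords_absorb => //.
  + exact: measurable_fun_pair.
  + by rewrite finset.in_setD1 eq_sym e12 e2J.
  + exact: indep_coords_absorb.
- rewrite big_cons expectation_prod_indep ?EG//.
  + by move=> w; exact: f0.
  + by move=> w; apply: prodr_ge0 => a _; exact: f0.
  + move=> B C mB mC; rewrite setIC [RHS]muleC.
    exact: (indep_coords_pair (D := (fun z => f e z.1 z.2) @^-1` B) mG e1J e2J
      e12 indG mC (measurable_preimage (mf e) mB)).
Qed.

End matching.

(** * One-sided sub-Gaussian variables *)

Section subgaussian.
Context d (T : measurableType d) (R : realType) (P : probability T R).

(** Here v is the variance proxy, the square of the usual parameter. *)
Definition upper_subgaussian (Y : T -> R) (v : R) : Prop :=
  forall lambda : R, 0 < lambda ->
    ('E_P[fun w => expR (lambda * Y w)] <= (expR (lambda ^+ 2 * v / 2))%:E)%E.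

(** Jensen's inequality: sum the tangent-line bound for exp at the barycentre. *)
Lemma expR_convex_sum (I : finType) (A : {set I}) (p x : I -> R) :
  (forall k, k \in A -> 0 <= p k) -> \sum_(k in A) p k = 1 ->
  expR (\sum_(k in A) p k * x k) <= \sum_(k in A) p k * expR (x k).
Proof.
move=> p0 p1; have [m mE] : exists m, m = \sum_(k in A) p k * x k by eexists.
rewrite -mE.
have -> : expR m = \sum_(k in A) p k * (expR m * (1 + (x k - m))).
  rewrite (eq_bigr (fun k => expR m * (p k * x k + (1 - m) * p k))); last first.
    by move=> k _; ring.
  by rewrite -mulr_sumr big_split/= -mulr_sumr p1 -mE; ring.
apply: ler_sum => k kA; rewrite ler_wpM2l ?p0//.
rewrite -[x k in leRHS](subrK m) expRD mulrC ler_wpM2r ?expR_ge0//.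
exact: expR_ge1Dx.
Qed.

Lemma sqr_sum_le_card (I : finType) (A : {set I}) (a : I -> R) :
  (\sum_(k in A) a k) ^+ 2 <= #|A|%:R * \sum_(k in A) a k ^+ 2.
Proof.
have [A0|A_gt0] := posnP #|A|.
  by rewrite A0 mul0r (cards0_eq A0) big_set0 expr0n.
have [q qE] : exists q, q = \sum_(k in A) a k by eexists.
have [N NE] : exists N : R, N = #|A|%:R by eexists.
have N0 : 0 < N by rewrite NE ltr0n.
rewrite -qE -NE.
(* Up to the factor N^2 this is the sum of squared deviations from the mean. *)
have : 0 <= \sum_(k in A) (N * a k - q) ^+ 2.
  by apply: sumr_ge0 => k _; exact: sqr_ge0.
have -> : \sum_(k in A) (N * a k - q) ^+ 2 =
    N * (N * \sum_(k in A) a k ^+ 2 - q ^+ 2).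
  rewrite (eq_bigr (fun k => N ^+ 2 * a k ^+ 2 +
    ((- 2 * N * q) * a k + q ^+ 2))); last by move=> k _; ring.
  rewrite !big_split/= -!mulr_sumr -qE sumr_const -(mulr_natl _ #|A|) -NE.
  ring.
by rewrite pmulr_rge0// subr_ge0.
Qed.

Lemma upper_subgaussian_le (Y : T -> R) (v v' : R) :
  v <= v' -> upper_subgaussian Y v -> upper_subgaussian Y v'.
Proof.
move=> vv' sY lambda l0; apply: (le_trans (sY _ l0)).
by rewrite lee_fin ler_expR ler_pM2r ?invr_gt0// ler_wpM2l ?sqr_ge0.
Qed.

(** The variables may be dependent in any way: the parameters a k, not the
    variances, add up.  The weights p k = a k / q are those for which
    (lambda / p k) * a k is the same for all k, namely lambda * q. *)
Lemma upper_subgaussian_sum (I : finType) (A : {set I}) (Y : I -> T -> R)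
    (a : I -> R) :
  A != finset.set0 -> (forall k, measurable_fun setT (Y k)) ->
  (forall k, k \in A -> 0 < a k) ->
  (forall k, k \in A -> upper_subgaussian (Y k) (a k ^+ 2)) ->
  upper_subgaussian (fun w => \sum_(k in A) Y k w) ((\sum_(k in A) a k) ^+ 2).
Proof.
move=> A0 mY a0 sY lambda l0; set q := \sum_(k in A) a k.
have q0 : 0 < q.
  have [k kA] := set0Pn _ A0.
  rewrite /q (bigD1 k)//= ltr_pwDl ?a0// sumr_ge0// => j /andP[jA _].
  by rewrite ltW ?a0.
pose p k := a k / q.
have p0 k : k \in A -> 0 < p k by move=> kA; rewrite divr_gt0 ?a0.
have p1 : \sum_(k in A) p k = 1 by rewrite -mulr_suml divff ?gt_eqF.
have mE k : measurable_fun setT (fun w => (expR (lambda / p k * Y k w))%:E).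
  apply/measurable_EFinP; apply: measurableT_comp => //.
  exact: measurable_funM.
(* The absolute value makes the summands nonnegative for k outside A as well. *)
rewrite unlock; apply: (@le_trans _ _ (\int[P]_w
    \sum_(k <- enum A) (`|p k| * expR (lambda / p k * Y k w))%:E))%E.
  apply: ge0_le_integral; first exact: measurableT.
  - by move=> w _; rewrite lee_fin expR_ge0.
  - apply/measurable_EFinP; apply: measurableT_comp => //.
    apply: measurable_funM => //.
    rewrite (_ : (fun w => _) = fun w => \sum_(k <- enum A) Y k w).
      exact: measurable_sum.
    by apply/funext => w; rewrite big_enum.
  - apply: emeasurable_sum => k; apply/measurable_EFinP.
    apply: measurable_funM => //.
    exact/measurable_EFinP/mE.
  - move=> w _; rewrite sumEFin lee_fin big_enum/=.
    have := expR_convex_sum (fun k => lambda / p k * Y k w)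
      (fun k kA => ltW (p0 k kA)) p1.
    rewrite mulr_sumr (eq_bigr (fun k => lambda * Y k w)) => [|k kA]; last first.
      by have := p0 k kA => pk; rewrite mulrA mulrCA mulfV ?gt_eqF// mulr1.
    move=> /le_trans; apply; apply: ler_sum => k kA.
    by rewrite gtr0_norm ?p0.
rewrite ge0_integral_sum//; last first.
  move=> k; apply/measurable_EFinP; apply: measurable_funM => //.
  exact/measurable_EFinP/mE.
rewrite big_enum/=.
have -> : (expR (lambda ^+ 2 * q ^+ 2 / 2))%:E =
    (\sum_(k in A) (p k * expR (lambda ^+ 2 * q ^+ 2 / 2))%:E)%E.
  by rewrite sumEFin -mulr_suml p1 mul1r.
apply: lee_sum => k kA.
under eq_integral do rewrite EFinM.
rewrite ge0_integralZl_EFin//.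
rewrite gtr0_norm ?p0// (EFinM (p k)) lee_pmul2l ?lte_fin ?p0//.
have lp : 0 < lambda / p k by rewrite divr_gt0 ?p0.
have := sY k kA _ lp; rewrite unlock => /le_trans; apply.
rewrite lee_fin ler_expR le_eqVlt; apply/orP; left; apply/eqP.
have := a0 k kA => ak.
by rewrite /p; field; rewrite ?gt_eqF.
Qed.

(** Chernoff's bound at lambda = t / v, which minimises
    lambda^2 v / 2 - lambda t. *)
Lemma upper_subgaussian_tail (Y : T -> R) (v t : R) :
  measurable_fun setT Y -> upper_subgaussian Y v -> 0 < v -> 0 < t ->
  (P [set w | (t < Y w)%R] <= (expR (- (t ^+ 2 / (2 * v))))%:E)%E.
Proof.
move=> mY sY v0 t0.
pose Y_mixin := isMeasurableFun.Build _ _ _ _ _ mY.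
pose Yr : {mfun T >-> R} := HB.pack Y Y_mixin.
have l0 : 0 < t / v by rewrite divr_gt0.
apply: (@le_trans _ _ (P [set w | (t <= Yr w)%R])).
  apply: le_measure; rewrite ?inE.
  - by rewrite -[X in measurable X]setTI; exact: measurable_fun_ltr.
  - by rewrite -[X in measurable X]setTI; exact: measurable_fun_ler.
  - by move=> w; exact: ltW.
apply: (le_trans (chernoff Yr t l0)).
have -> : ('M_P Yr (t / v) = 'E_P[fun w => expR (t / v * Y w)])%E.
  by rewrite /mmt_gen_fun; congr expectation; apply/funext => w /=; rewrite mulrC.
apply: (le_trans (lee_wpmul2r _ (sY _ l0))); first by rewrite lee_fin expR_ge0.
rewrite -EFinM lee_fin -expRD ler_expR le_eqVlt; apply/orP; left; apply/eqP.
by field; rewrite gt_eqF.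
Qed.

End subgaussian.

(** * Sums over the edges of a graph *)

Section moments.
Context d (T : measurableType d) (R : realType) (P : probability T R).

Lemma upper_subgaussian_matching (I : finType) dX (T' : measurableType dX)
    (X : I -> {RV P >-> T'}) (A : eqType) (ends : A -> I * I)
    (g : A -> T' -> T' -> R) (v : A -> R) (s : seq A) :
  mutually_independent X ->
  (forall e, measurable_fun setT (fun z : T' * T' => g e z.1 z.2)) ->
  all (fun e => (ends e).1 != (ends e).2) s ->
  pairwise (fun e e' => [set (ends e).1; (ends e).2]%SET
    :&: [set (ends e').1; (ends e').2]%SET == finset.set0) s ->
  (forall e, e \in s ->
    upper_subgaussian P (fun w => g e (X (ends e).1 w) (X (ends e).2 w))
      (v e)) ->
  upper_subgaussian P
    (fun w => \sum_(e <- s) g e (X (ends e).1 w) (X (ends e).2 w))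
    (\sum_(e <- s) v e).
Proof.
move=> indX mg ends_s disj_s sG lambda l0.
have mf e : measurable_fun setT
    (fun z : T' * T' => expR (lambda * g e z.1 z.2)).
  by apply: measurableT_comp => //; exact: measurable_funM.
have [_ prodE] := matching_indep indX mf
  (fun e x y => expR_ge0 (lambda * g e x y)) ends_s disj_s.
under eq_fun do rewrite mulr_sumr expR_sum.
rewrite prodE mulr_sumr mulr_suml expR_sum.
elim: s sG {ends_s disj_s prodE} => [|e s IHs] sG; first by rewrite !big_nil.
rewrite !big_cons EFinM lee_pmul//.
- by apply: expectation_ge0 => w; exact: expR_ge0.
- by apply: prode_ge0 => a _; apply: expectation_ge0 => w; exact: expR_ge0.
- by apply: sG => //; rewrite mem_head.
- by apply: IHs => a sa; apply: sG; rewrite inE sa orbT.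
Qed.

(** Summands outside A are replaced by 0, since linearity of the integral asks
    for integrability at every index. *)
Lemma expectation_sum_in (I : finType) (A : {set I}) (Y : I -> T -> R) :
  (forall k, k \in A -> P.-integrable setT (EFin \o Y k)) ->
  ('E_P[fun w => (\sum_(k in A) Y k w)%R] = \sum_(k in A) 'E_P[Y k])%E.
Proof.
move=> iY; rewrite unlock.
pose f k : T -> \bar R := if k \in A then EFin \o Y k else cst 0%E.
have if_ k : P.-integrable setT (f k).
  by rewrite /f; case: ifPn => [/iY//|_]; exact: integrable0.
rewrite (eq_bigr (fun k => \int[P]_w f k w)%E) => [|k kA]; last by rewrite /f kA.
rewrite -integral_sum//; apply: eq_integral => w _.
by rewrite -sumEFin; apply: eq_bigr => k kA; rewrite /f kA.
Qed.

End moments.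

Theorem theorem1 (d : measure_display) (T : measurableType d) (R : realType)
    (P : probability T R) (p n K : nat)
    (X : 'I_n -> {RV P >-> p.-tuple R})
    (hX : mutually_independent X)
    (E : {set {set 'I_n}}) (hE : simple_graph E) (hE0 : E != finset.set0)
    (ends : {set 'I_n} -> 'I_n * 'I_n) (hends : edge_ordering E ends)
    (h : {set 'I_n} -> p.-tuple R -> p.-tuple R -> R)
    (hmeas : forall e, e \in E ->
       measurable_fun [set: p.-tuple R * p.-tuple R] (fun z => h e z.1 z.2))
    (hint : forall e, e \in E ->
       P.-integrable [set: T] (EFin \o edge_kernel X ends h e))
    (sigma : {set 'I_n} -> R)
    (hsigma : forall e, e \in E -> 0 < sigma e)
    (hsubG : forall e, e \in E -> forall lambda : R, 0 < lambda ->
       ('E_P[fun w => expR (lambda * (edge_kernel X ends h e w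
                                      - fine 'E_P[edge_kernel X ends h e]))]
        <= (expR (lambda ^+ 2 * sigma e ^+ 2 / 2))%:E)%E)
    (hK : exists c : {set 'I_n} -> 'I_K, proper_edge_coloring E c)
    (t : R) (ht : 0 < t) :
  (P [set w | t < graph_Ustat X E ends h w - fine 'E_P[graph_Ustat X E ends h]]%R
   <= (expR (- (t ^+ 2 / (2 * K%:R * \sum_(e in E) sigma e ^+ 2))))%:E)%E.
Proof.
have [c hc] := hK.
(* The centred kernels, set to 0 off E so that they are measurable for every e. *)
pose m e := fine 'E_P[edge_kernel X ends h e].
pose g e x y := if e \in E then h e x y - m e else 0.
pose Z e w := g e (X (ends e).1 w) (X (ends e).2 w).
have mg e : measurable_fun setT
    (fun z : p.-tuple R * p.-tuple R => g e z.1 z.2).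
  rewrite /g; case: (boolP (e \in E)) => eE; last exact: measurable_cst.
  by apply: measurable_funB => //; exact: hmeas.
have mZ e : measurable_fun setT (Z e).
  apply: (measurableT_comp (mg e)
    (_ : measurable_fun setT (fun w => (X (ends e).1 w, X (ends e).2 w)))).
  exact: measurable_fun_pair.
have sZ e : e \in E -> upper_subgaussian P (Z e) (sigma e ^+ 2).
  by move=> eE; rewrite /Z /g eE; exact: hsubG.
have centred w : graph_Ustat X E ends h w - fine 'E_P[graph_Ustat X E ends h] =
    \sum_(e in E) Z e w.
  have -> : ('E_P[graph_Ustat X E ends h] = (\sum_(e in E) m e)%:E)%E.
    rewrite expectation_sum_in// -sumEFin; apply: eq_bigr => e eE.
    rewrite fineK// unlock.
    exact: (integrable_fin_num measurableT (hint _ eE)).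
  by rewrite -sumrB; apply: eq_bigr => e eE; rewrite /Z /g eE.
(* The edges of one color form a matching. *)
pose s k := [seq e <- enum E | c e == k].
pose v k := \sum_(e <- s k) sigma e ^+ 2.
have sE e k : e \in s k -> e \in E by rewrite mem_filter mem_enum => /andP[].
have sY k : upper_subgaussian P (fun w => \sum_(e <- s k) Z e w) (v k).
  apply: upper_subgaussian_matching => //.
  - apply/allP => e /sE eE; apply/eqP => e12.
    by have := hE _ eE; rewrite (hends _ eE) cards2 e12 eqxx.
  - have : uniq (s k) by rewrite filter_uniq ?enum_uniq.
    rewrite uniq_pairwise.
    apply: (sub_in_pairwise (P := mem (s k))); last exact/allP.
    move=> e e' es es' ee'.
    rewrite -(hends _ (sE _ _ es)) -(hends _ (sE _ _ es')).
    apply: contraT => ndisj; have := hc _ _ (sE _ _ es) (sE _ _ es') ee' ndisj.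
    move: es es'; rewrite !mem_filter => /andP[/eqP-> _] /andP[/eqP-> _].
    by rewrite eqxx.
  - by move=> e /sE eE; exact: sZ.
(* Only the colors in use: their proxies are positive, hence so are the
   weights. *)
pose C := [set c e | e in E]%SET.
have v0 k : k \in C -> 0 < v k.
  move=> /imsetP[e eE ->]; rewrite /v big_filter big_enum_cond.
  rewrite (bigD1 e)/= ?eE ?eqxx//.
  by rewrite ltr_pwDl ?exprn_gt0 ?hsigma// sumr_ge0// => a _; exact: sqr_ge0.
have C0 : C != finset.set0.
  by have /set0Pn[e eE] := hE0; apply/set0Pn; exists (c e); exact: imset_f.
have by_color (F : {set 'I_n} -> R) :
    \sum_(e in E) F e = \sum_(k in C) \sum_(e <- s k) F e.
  rewrite (partition_big c (mem C)) => [|e eE]; last exact: imset_f.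
  apply: eq_bigr => k _; rewrite /s big_filter big_enum_cond.
  by apply: eq_bigl => e.
have sumC : upper_subgaussian P (fun w => \sum_(e in E) Z e w)
    (K%:R * \sum_(e in E) sigma e ^+ 2).
  under eq_fun do rewrite by_color.
  apply: upper_subgaussian_le (upper_subgaussian_sum
    (a := fun k => Num.sqrt (v k)) C0 _ _ _) => //.
  - apply: le_trans (sqr_sum_le_card _ _) _.
    rewrite by_color (eq_bigr v) => [|k kC]; last by rewrite sqr_sqrtr ?ltW ?v0.
    rewrite ler_wpM2r//; first by apply: sumr_ge0 => k kC; rewrite ltW ?v0.
    by rewrite ler_nat -[leqRHS]card_ord max_card.
  - by move=> k; exact: measurable_sum.
  - by move=> k kC; rewrite sqrtr_gt0 v0.
  - by move=> k kC; rewrite sqr_sqrtr ?ltW ?v0.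
have V0 : 0 < K%:R * \sum_(e in E) sigma e ^+ 2.
  have /set0Pn[k kC] := C0.
  rewrite mulr_gt0 ?ltr0n ?(leq_ltn_trans _ (ltn_ord k))// by_color.
  by rewrite (bigD1 k)//= ltr_pwDl ?v0// sumr_ge0// => j /andP[/v0/ltW].
under eq_set do rewrite centred.
rewrite -(mulrA 2); apply: upper_subgaussian_tail => //.
under eq_fun do rewrite -big_enum/=.
exact: measurable_sum.
Qed.
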